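(* Let $d, M, N \ge 1$ be integers, let $\mathcal{S} = \{\mathbf{a}_1,\dots,\mathbf{a}_N\} \subset \mathbb{R}^d$ be a set of $N$ distinct candidate beacon positions, and let $f_{\mathrm{D}}^+ : 2^{\mathcal{S}} \to \mathbb{R}$, $f_{\mathrm{D}}^+(S) = f_{\mathrm{D}}(S) - f_{\mathrm{D}}(\emptyset)$, be the shifted D-optimal beacon placement objective defined in the context, where $f_{\mathrm{D}}(S) = \log\det\left(\mathcal{I}(S) + \mathcal{I}_0\right)$. Then $f_{\mathrm{D}}^+$ is normalized, monotone, and submodular. Moreover, for every integer $K$ with $1 \le K < N$, every set $S_g \subset \mathcal{S}$ with $|S_g| = K$ produced by the greedy algorithm (described in the context) applied to $f_{\mathrm{D}}^+$ satisfies $$f_{\mathrm{D}}^+(S_g) \ \ge\ \left(1 - \frac{1}{e}\right) f_{\mathrm{D}}^+(S^\star),$$ where $S^\star$ is any maximizer of $f_{\mathrm{D}}^+$ over $\{S \subseteq \mathcal{S} : |S| \le K\}$ and $e$ is the base of the natural logarithm.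
   Context: Measurement setting. There are $M$ unknown positions $\mathbf{x}_1,\dots,\mathbf{x}_M \in \mathbb{R}^d$ with ground truth values $\bar{\mathbf{x}}_1,\dots,\bar{\mathbf{x}}_M \in \mathbb{R}^d$. Write $[n] = \{1,\dots,n\}$. A neighbourhood function $\nu : [M] \to 2^{[N]}$ specifies for each position $i$ the set $\nu(i)$ of indices of candidate beacons whose range can be measured from position $i$. It is assumed that $\bar{\mathbf{x}}_i \ne \mathbf{a}_j$ whenever $j \in \nu(i)$. Each position has an independent Gaussian prior whose covariance matrix $\check{\boldsymbol{\Sigma}}_i \in \mathbb{R}^{d\times d}$ is symmetric positive definite. For each $i\in[M]$, $j \in \nu(i)$, a range measurement $\tilde d_{ij} \in \mathbb{R}$ with noise variance $\sigma_{ij}^2 > 0$ is given; its conditional density given $\mathbf{x}_i$ is the Gaussian density $p_{ij}(\cdot \mid \mathbf{x}_i)$ with mean $\|\mathbf{x}_i - \mathbf{a}_j\|_2$ and variance $\sigma_{ij}^2$ (the variance is treated as a constant when differentiating in $\mathbf{x}_i$). Information matrices. For $i \in [M]$ and $j \in \nu(i)$ let $$\mathbf{g}_{ij} = \nabla_{\mathbf{x}_i} \log p_{ij}(\tilde d_{ij} \mid \mathbf{x}_i)\Big|_{\mathbf{x}_i = \bar{\mathbf{x}}_i} = \frac{\tilde d_{ij} - \|\bar{\mathbf{x}}_i - \mathbf{a}_j\|_2}{\sigma_{ij}^2}\cdot\frac{\bar{\mathbf{x}}_i - \mathbf{a}_j}{\|\bar{\mathbf{x}}_i - \mathbf{a}_j\|_2}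 \in \mathbb{R}^d .$$ The prior information matrix is the $dM \times dM$ block-diagonal matrix $\mathcal{I}_0 = \mathrm{Diag}(\check{\boldsymbol{\Sigma}}_1^{-1},\dots,\check{\boldsymbol{\Sigma}}_M^{-1})$. For $S \subseteq \mathcal{S}$, the Fisher information matrix (with the expectation over measurements replaced by its one-sample approximation at the observed measurements, and block-diagonal because the measurements and priors of different positions are independent) is the $dM \times dM$ block-diagonal matrix $$\mathcal{I}(S) = \mathrm{Diag}\left(\sum_{j \in \nu(1),\ \mathbf{a}_j \in S} \mathbf{g}_{1j}\mathbf{g}_{1j}^\top,\ \dots,\ \sum_{j \in \nu(M),\ \mathbf{a}_j \in S} \mathbf{g}_{Mj}\mathbf{g}_{Mj}^\top\right),$$ where empty sums are zero. The objective is $f_{\mathrm{D}}(S) = \log\det(\mathcal{I}(S) + \mathcal{I}_0)$. Set function notions. A set function $f : 2^{\mathcal{S}} \to \mathbb{R}$ is normalized if $f(\emptyset) = 0$; monotone if $f(A) \le f(B)$ for all $A \subseteq B \subseteq \mathcal{S}$; submodular if $f(A \cup \{s\}) - f(A) \ge f(B \cup \{s\}) - f(B)$ for all $A \subseteq B \subset \mathcal{S}$ and $s \in \mathcal{S} \setminus B$. Greedy algorithm. Given $f : 2^{\mathcal{S}} \to \mathbb{R}$ and a budget $K$, start with $S = \emptyset$ and, $K$ times, choose some $s^\star \in \arg\max_{s \in \mathcal{S}\setminus S} f(S \cup \{s\})$ (ties broken arbitrarily) and replace $S$ by $S \cup \{s^\star\}$; return $S$. *)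

(* Defs.v *)
From HB Require Import structures.
From mathcomp Require Import all_boot all_order all_algebra.
From mathcomp Require Import all_classical all_reals all_analysis ring.

Set Implicit Arguments.
Unset Strict Implicit.
Unset Printing Implicit Defensive.

Import Order.TTheory GRing.Theory Num.Theory.
Import numFieldNormedType.Exports.

Local Open Scope ring_scope.

Section SetFunctions.
Variables (R : realType) (T : finType).
Implicit Types (f : {set T} -> R) (A B S : {set T}) (s t : T) (K : nat).

Definition normalized_setfun f := f finset.set0 = 0.

Definition monotone_setfun f := forall A B, A \subset B -> f A <= f B.

Definition submodular_setfun f := forall A B s, A \subset B -> s \notin B ->
  f (A :|: [set s]) - f A >= f (B :|: [set s]) - f B.

(* A relation rather than a function, since ties may be broken arbitrarily:
   [greedy f K S] means that some run of the algorithm with budget [K]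
   returns [S]. *)
Inductive greedy f : nat -> {set T} -> Prop :=
| greedy_start : greedy f 0 finset.set0
| greedy_step K S s :
    greedy f K S ->
    s \notin S ->
    (forall t, t \notin S -> f (S :|: [set t]) <= f (S :|: [set s])) ->
    greedy f K.+1 (S :|: [set s]).

Definition budget_maximizer f K S :=
  (#|S| <= K)%N /\ forall S', (#|S'| <= K)%N -> f S' <= f S.

End SetFunctions.

Section Vectors.
Variables (R : realType) (d : nat).

(* The norm [`|x|] that the library puts on matrices is the sup norm. *)
Definition norm2 (x : 'cV[R]_d) : R := Num.sqrt (\sum_k x k 0 ^+ 2).

Definition grad (f : 'cV[R]_d -> R) (x : 'cV[R]_d) : 'cV[R]_d :=
  \col_k 'D_(delta_mx k 0) f x.

Definition sym_posdef (A : 'M[R]_d) :=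
  A^T = A /\ forall x : 'cV[R]_d, x != 0 -> 0 < (x^T *m A *m x) 0 0.

End Vectors.

Section BeaconPlacement.
Variables (R : realType) (d M N : nat).
(* positions of the candidate beacons *)
Variable a : 'I_N -> 'cV[R]_d.
(* ground truth positions, and the covariance matrices of their priors *)
Variables (xbar : 'I_M -> 'cV[R]_d) (Sigma : 'I_M -> 'M[R]_d).
(* neighbourhoods; noise standard deviations and observed ranges, which are
   only relevant at pairs (i, j) with j \in nu i *)
Variables (nu : 'I_M -> {set 'I_N}) (sigma dtil : 'I_M -> 'I_N -> R).

(* The finite type of the points of {a_1, ..., a_N}. *)
Definition beacons : finType := seq_sub (codom a).

Definition beacon (j : 'I_N) : beacons := SeqSub (codom_f a j).

(* The second argument of [normal_pdf] is the standard deviation. *)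
Definition range_pdf i j (y : R) (x : 'cV[R]_d) : R :=
  normal_pdf (norm2 (x - a j)) (sigma i j) y.

Definition score i j : 'cV[R]_d :=
  grad (fun x => ln (range_pdf i j (dtil i j) x)) (xbar i).

Definition prior_info : 'M[R]_(\sum_(i < M) d) :=
  \mxdiag_(i < M) invmx (Sigma i).

Definition fisher_info (S : {set beacons}) : 'M[R]_(\sum_(i < M) d) :=
  \mxdiag_(i < M)
    \sum_(j in nu i | beacon j \in S) score i j *m (score i j)^T.

Definition fD (S : {set beacons}) : R :=
  ln (\det (fisher_info S + prior_info)).

Definition fDplus (S : {set beacons}) : R := fD S - fD finset.set0.

End BeaconPlacement.

Arguments beacon {R d N} a j.
Arguments range_pdf {R d M N} a sigma i j y x.
Arguments score {R d M N} a xbar sigma dtil i j.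
Arguments prior_info {R d M} Sigma.
Arguments fisher_info {R d M N} a xbar nu sigma dtil S.
Arguments fD {R d M N} a xbar Sigma nu sigma dtil S.
Arguments fDplus {R d M N} a xbar Sigma nu sigma dtil S.

Lemma derive_line (R : realType) (d : nat) (F : 'cV[R]_d -> R) (h : R -> R)
    (x v : 'cV[R]_d) :
  (forall t, F (t *: v + x) = h t) -> 'D_v F x = 'D_1 h 0.
Proof.
move=> FE; have Fx : F x = h 0 by rewrite -FE scale0r add0r.
rewrite /derive.
apply: (f_equal (fun G : R -> R => lim (fmap G (dnbhs (0 : R))))).
apply/funext => t /=; rewrite FE Fx.
have -> : t%R *: (1 : R^o) + 0 = t by rewrite addr0 -[LHS]/(t * 1) mulr1.
by [].
Qed.

Lemma is_derive_quadratic (R : realType) (c w : R) :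
  is_derive (0 : R) 1 (cst c + (cst w * id + id * id)) w.
Proof.
apply: is_derive_eq.
by rewrite /GRing.scale /= /cst; ring.
Qed.

(* The closed form of the score vectors; in particular the partial
   derivatives taken in [score] are not junk values. *)
Lemma scoreE (R : realType) (d M N : nat) (a : 'I_N -> 'cV[R]_d)
    (xbar : 'I_M -> 'cV[R]_d) (sigma dtil : 'I_M -> 'I_N -> R) i j :
  xbar i != a j -> 0 < sigma i j ^+ 2 ->
  score a xbar sigma dtil i j =
  ((dtil i j - norm2 (xbar i - a j)) / sigma i j ^+ 2) *:
    ((norm2 (xbar i - a j))^-1 *: (xbar i - a j)).
Proof.
move=> xa; rewrite exprn_even_gt0 //= => s0.
rewrite /score /grad; apply/colP => k; rewrite mxE [RHS]mxE [X in _ * X]mxE.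
set s := sigma i j in s0 *; set y := dtil i j.
set u := xbar i - a j.
have ssq0 : 0 < \sum_k u k 0 ^+ 2.
  rewrite lt0r sumr_ge0 ?andbT; last by move=> *; rewrite sqr_ge0.
  apply: contra_neq xa => /eqP; rewrite psumr_eq0; last first.
    by move=> *; rewrite sqr_ge0.
  move=> /allP u0; apply/eqP; rewrite -subr_eq0; apply/eqP/colP => m.
  have := u0 m (mem_index_enum _); rewrite /= sqrf_eq0 => /eqP um0.
  by rewrite -/u um0 mxE.
pose q (t : R) : R := \sum_m u m 0 ^+ 2 + (t * u k 0 *+ 2 + t ^+ 2).
pose h (t : R) : R :=
  ln (normal_peak s) - (y - Num.sqrt (q t)) ^+ 2 / (s ^+ 2 *+ 2).
have q0 : q 0 = \sum_m u m 0 ^+ 2 by rewrite /q mul0r mul0rn expr0n /= !addr0.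
have hE t : ln (range_pdf a sigma i j y (t *: delta_mx k 0 + xbar i)) = h t.
  rewrite /range_pdf normal_pdfE // lnM ?posrE ?normal_peak_gt0 ?expR_gt0 //.
  rewrite /normal_fun expRK /h mulNr; congr (_ - (y - Num.sqrt _) ^+ 2 / _).
  rewrite -addrA -/u /q (bigD1 k) //= [X in X + (_ + _)](bigD1 k) //=.
  rewrite (eq_bigr (fun m => u m 0 ^+ 2)); last first.
    by move=> m /negPf mk; rewrite mxE [X in X + _]mxE mxE mk mulr0 add0r.
  rewrite mxE [X in (X + _) ^+ 2]mxE mxE !eqxx mulr1.
  ring.
rewrite (derive_line hE).
have dq : is_derive (0 : R) 1 q (u k 0 *+ 2).
  have -> : q = cst (\sum_m u m 0 ^+ 2) + (cst (u k 0 *+ 2) * id + id * id).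
    by apply/funext => t; rewrite /q !fctE /=; ring.
  exact: is_derive_quadratic.
have dr : is_derive (0 : R) 1 (Num.sqrt \o q)
    ((2 * Num.sqrt (q 0))^-1 * (u k 0 *+ 2)).
  by apply: is_derive1_comp; apply: is_derive1_sqrt; rewrite q0.
pose r := cst y - (Num.sqrt \o q).
have dh : is_derive (0 : R) 1 h
    (- ((y - Num.sqrt (q 0)) *+ 2 *
        (- ((2 * Num.sqrt (q 0))^-1 * (u k 0 *+ 2)))) / (s ^+ 2 *+ 2)).
  have -> : h = cst (ln (normal_peak s)) - (r * r) * cst (s ^+ 2 *+ 2)^-1.
    by apply/funext => t; rewrite /h /r !fctE /= expr2.
  have dr' : is_derive (0 : R) 1 r (0 - (2 * Num.sqrt (q 0))^-1 * (u k 0 *+ 2)).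
    exact: is_deriveB.
  apply: is_derive_eq.
  by rewrite /GRing.scale /= /cst /r !fctE /=; ring.
rewrite derive_val q0 /norm2 -/u.
have sq_neq0 : Num.sqrt (\sum_m u m 0 ^+ 2) != 0 by rewrite gt_eqF // sqrtr_gt0.
by field; apply/andP.
Qed.

(* Main.v *)
(** Both information matrices are block diagonal, so [fD] is a sum over the
positions of log-determinants of a positive definite matrix plus a sum of outer
products [g *m g^T].  Adding one outer product multiplies a determinant
[\det A] by [1 + g^T A^-1 g]; this factor is at least 1, which gives
monotonicity, and it decreases as [A] grows in the Loewner order, which gives
submodularity.  The guarantee is the Nemhauser-Wolsey-Fisher argument: each
greedy step closes at least a fraction [1 / K] of the gap to the optimum, and
[(1 - 1 / K) ^+ K <= expR (- 1)]. *)

Require Import Defs.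
From mathcomp Require Import all_boot all_order all_algebra.
From mathcomp Require Import all_classical all_reals all_analysis.
From mathcomp Require Import ring lra.

Import Order.TTheory GRing.Theory Num.Theory.
Local Open Scope ring_scope.

Set Implicit Arguments.
Unset Strict Implicit.
Unset Printing Implicit Defensive.

(** * Determinants of block-diagonal matrices and of rank-one updates *)

Section Determinants.

Lemma det_castmx (R : comPzRingType) (m n : nat) (e : m = n) (A : 'M[R]_m) :
  \det (castmx (e, e) A) = \det A.
Proof. by case: n / e; rewrite castmx_id. Qed.

Lemma det_mxdiag (R : comPzRingType) (m : nat) (p : 'I_m -> nat)
    (A : forall i, 'M[R]_(p i)) :
  \det (\mxdiag_i A i) = \prod_i \det (A i).
Proof.
elim: m p A => [|m IHm] p A.
  (* The size [\sum_(i < 0) p i] is only provably equal to [0], so the empty case is stated for any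
     [k] with [k = 0]. *)
  have d0 k (B : 'M[R]_k) : k = 0%N -> \det B = 1.
    by move=> k0; move: B; rewrite k0 => B; rewrite det_mx00.
  by rewrite [RHS]big_ord0 d0 // big_ord0.
by rewrite mxdiag_recl det_castmx det_ublock IHm big_ord_recl.
Qed.

(* Matrix determinant lemma: two block factorizations of
   [[1, - w], [v, A]]. *)
Lemma det_rank1_update (R : comUnitRingType) (n : nat) (A : 'M[R]_n)
    (v : 'cV[R]_n) (w : 'rV[R]_n) :
  A \in unitmx ->
  \det (A + v *m w) = \det A * (1 + (w *m invmx A *m v) 0 0).
Proof.
move=> Au.
pose B := block_mx (1%:M : 'M[R]_1) (- w) v A.
have eB1 : B = block_mx 1%:M 0 v 1%:M *m block_mx 1%:M (- w) 0 (A + v *m w).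
  rewrite mulmx_block !(mul1mx, mul0mx, mulmx0, mulmx1, addr0).
  by rewrite mulmxN addrC addrK.
have eB2 : B = block_mx (1%:M + w *m invmx A *m v) (- w *m invmx A) 0 1%:M
    *m block_mx 1%:M 0 v A.
  rewrite mulmx_block !(mul1mx, mul0mx, mulmx0, mulmx1, add0r) mulmxKV //.
  by rewrite !mulNmx addrK.
have := congr1 determinant eB1.
rewrite {1}eB2 !det_mulmx !det_ublock !det_lblock !det1 !mul1r !mulr1.
by rewrite det_mx11 !mxE mulrC.
Qed.

End Determinants.

(** * Positive definite matrices, their inverses and their determinants *)

Section PositiveSemidefinite.
Variables (R : realType) (n : nat).
Implicit Types (A B Q : 'M[R]_n) (v x y : 'cV[R]_n).

Definition qform A x : R := (x^T *m A *m x) 0 0.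

Definition sym_possemidef Q := Q^T = Q /\ forall x, 0 <= qform Q x.

Lemma qformD A B x : qform (A + B) x = qform A x + qform B x.
Proof. by rewrite /qform mulmxDr mulmxDl mxE. Qed.

Lemma qformZ c A x : qform (c *: A) x = c * qform A x.
Proof. by rewrite /qform -scalemxAr -scalemxAl mxE. Qed.

Lemma qform_outer v x : qform (v *m v^T) x = ((v^T *m x) 0 0) ^+ 2.
Proof.
have -> : qform (v *m v^T) x = ((v^T *m x)^T *m (v^T *m x)) 0 0.
  by rewrite /qform trmx_mul trmxK !mulmxA.
by rewrite mxE big_ord1 mxE expr2.
Qed.

Lemma qform1_gt0 x : x != 0 -> 0 < qform 1%:M x.
Proof.
move=> x0; rewrite /qform mulmx1 mxE lt0r sumr_ge0 ?andbT; last first.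
  by move=> k _; rewrite mxE -expr2 sqr_ge0.
apply: contra_neq x0 => /eqP; rewrite psumr_eq0; last first.
  by move=> k _; rewrite mxE -expr2 sqr_ge0.
move=> /allP x0; apply/colP => k; rewrite mxE.
by have := x0 k (mem_index_enum _); rewrite mxE mulf_eq0 orbb => /eqP.
Qed.

Lemma sym_possemidef0 : sym_possemidef 0.
Proof. by split=> [|x]; rewrite ?trmx0 // /qform mulmx0 mul0mx mxE. Qed.

Lemma sym_possemidefD A B :
  sym_possemidef A -> sym_possemidef B -> sym_possemidef (A + B).
Proof.
move=> [As A0] [Bs B0]; split=> [|x]; first by rewrite linearD /= As Bs.
by rewrite qformD addr_ge0.
Qed.

Lemma sym_possemidef_outer v : sym_possemidef (v *m v^T).
Proof.
by split=> [|x]; [rewrite trmx_mul trmxK | rewrite qform_outer sqr_ge0].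
Qed.

Lemma sym_possemidef_sum_outer (I : Type) (r : seq I) (P : pred I)
    (v : I -> 'cV[R]_n) :
  sym_possemidef (\sum_(i <- r | P i) v i *m (v i)^T).
Proof.
apply: (big_ind sym_possemidef); first exact: sym_possemidef0.
  exact: sym_possemidefD.
by move=> i _; exact: sym_possemidef_outer.
Qed.

(** A nonzero row [k] of the left kernel would give [k *m A *m k^T = 0], against positivity at
    [k^T]. *)
Lemma sym_posdef_unitmx A : sym_posdef A -> A \in unitmx.
Proof.
move=> [As A0]; rewrite -row_free_unit -kermx_eq0.
apply/eqP/row_matrixP => i; rewrite row0; apply/eqP.
rewrite -trmx_eq0; apply/negP => /negP k0.
have /sub_kermxP kA : (row i (kermx A) <= kermx A)%MS by exact: row_sub.
have := A0 _ k0.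
by rewrite trmxK kA mul0mx mxE ltxx.
Qed.

Lemma sym_posdefD A Q :
  sym_posdef A -> sym_possemidef Q -> sym_posdef (A + Q).
Proof.
move=> [As A0] [Qs Q0]; split=> [|x x0]; first by rewrite linearD /= As Qs.
by rewrite -/(qform _ x) qformD ltr_wpDr // A0.
Qed.

(* The segment from the identity to [A] consists of positive definite, hence
   invertible, matrices, so the determinant does not vanish along it. *)
Lemma sym_posdef_det_gt0 A : sym_posdef A -> 0 < \det A.
Proof.
move=> Apd; rewrite ltNge; apply/negP => dA.
(* The sign gives [p.[0] = -1] and [p.[1] = - \det A >= 0], the order in which the intermediate
   value theorem needs them. *)
pose p := - \det (map_mx polyC 1%:M + 'X *: map_mx polyC (A - 1%:M)).
have pE t : p.[t] = - \det (1%:M + t *: (A - 1%:M)).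
  rewrite /p hornerN -horner_evalE -det_map_mx; congr (- \det _).
  apply/matrixP => i j.
  by rewrite !mxE -[LHS]/(horner _ t) !hornerE.
have [|t] := @poly_ivt R p 0 1 ler01.
  rewrite !pE scale0r addr0 det1 oppr_le0 ler01 scale1r addrC subrK.
  by rewrite oppr_ge0.
move=> /andP[t0 t1]; rewrite rootE pE oppr_eq0 => /eqP d0.
have : sym_posdef (1%:M + t *: (A - 1%:M)).
  split; first by rewrite linearD /= linearZ /= linearB /= Apd.1 trmx1.
  move=> x x0; rewrite -/(qform _ x) qformD qformZ qformD -scaleN1r qformZ.
  have := Apd.2 x x0; rewrite -/(qform A x) => qA.
  have q1 := qform1_gt0 x0.
  (* The form is [(1 - t) * qform 1%:M x + t * qform A x]: the first term is positive at [t = 0],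
     the second for [t > 0]. *)
  have [->|tn0] := eqVneq t 0; first by rewrite mul0r addr0.
  have tgt0 : 0 < t by rewrite lt0r tn0.
  have h1 : 0 < t * qform A x by rewrite mulr_gt0.
  have h2 : 0 <= (1 - t) * qform 1%:M x by rewrite mulr_ge0 ?subr_ge0 // ltW.
  lra.
by move/sym_posdef_unitmx; rewrite unitmxE d0 unitr0.
Qed.

(** Substituting [y = A^-1 x] turns [x^T A^-1 x] into [y^T A y]. *)
Lemma sym_posdef_inv A : sym_posdef A -> sym_posdef (invmx A).
Proof.
move=> Apd; have Au := sym_posdef_unitmx Apd; have [As A0] := Apd.
split=> [|x x0]; first by rewrite trmx_inv As.
have y0 : invmx A *m x != 0.
  by apply: contra_neq x0 => e; rewrite -(mulKVmx Au x) e mulmx0.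
have := A0 _ y0.
by rewrite trmx_mul trmx_inv As (mulmxKV Au) mulmxA.
Qed.

(* [v^T A^-1 v] is the maximum over [x] of [2 x^T v - x^T A x]; test it at
   [x = (A + Q)^-1 v]. *)
Lemma qform_inv_antitone A Q v :
  sym_posdef A -> sym_possemidef Q ->
  qform (invmx (A + Q)) v <= qform (invmx A) v.
Proof.
move=> Apd Qpsd; have Bpd := sym_posdefD Apd Qpsd.
have Au := sym_posdef_unitmx Apd; have Bu := sym_posdef_unitmx Bpd.
set B := A + Q in Bpd Bu *.
pose x := invmx B *m v; pose y := invmx A *m v.
have [As A0] := Apd; have [Bs _] := Bpd.
(* Completing the square: this is the maximum, attained at [y], minus the value at [x]. *)
have gap : 0 <= qform A (x - y).
  have [->|xy] := eqVneq (x - y) 0; last by rewrite ltW // A0.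
  by rewrite /qform mulmx0 mxE.
have xT : x^T = v^T *m invmx B by rewrite trmx_mul trmx_inv Bs.
have yT : y^T = v^T *m invmx A by rewrite trmx_mul trmx_inv As.
have Ay : A *m y = v by rewrite mulKVmx.
have xv : (x^T *m v) 0 0 = qform (invmx B) v by rewrite xT.
have vx : (v^T *m x) 0 0 = qform (invmx B) v by rewrite /qform mulmxA.
have qBx : qform B x = qform (invmx B) v.
  by rewrite /qform xT mulmxKV // /x mulmxA.
have yAx : y^T *m A *m x = v^T *m x by rewrite yT mulmxKV.
have qAxy : qform A (x - y) =
    qform A x - qform (invmx B) v - qform (invmx B) v + qform (invmx A) v.
  have dT : (x - y)^T = x^T - y^T by rewrite linearB.
  rewrite -{1}xv -vx /qform dT !(mulmxBl, mulmxBr).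
  by rewrite yAx -[x^T *m A *m y]mulmxA -[y^T *m A *m y]mulmxA Ay yT !mxE; ring.
(* Since [qform A x = qform (invmx B) v - qform Q x], the gap equals [qform (invmx A) v - qform
   (invmx B) v - qform Q x]. *)
have : 0 <= qform Q x by apply: Qpsd.2.
by move: gap qBx; rewrite qAxy /B qformD; lra.
Qed.

Lemma det_add_outer A v :
  A \in unitmx -> \det (A + v *m v^T) = \det A * (1 + qform (invmx A) v).
Proof. exact: det_rank1_update. Qed.

Lemma det_le_add_sum_outer A (I : Type) (r : seq I) (P : pred I)
    (v : I -> 'cV[R]_n) :
  sym_posdef A -> \det A <= \det (A + \sum_(i <- r | P i) v i *m (v i)^T).
Proof.
move=> Apd; elim: r => [|i r IHr]; first by rewrite big_nil addr0.
rewrite big_cons; case: (P i) => //; rewrite addrCA addrC.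
set B := A + _ in IHr *.
have Bpd : sym_posdef B by apply: sym_posdefD => //; exact: sym_possemidef_sum_outer.
rewrite det_add_outer ?sym_posdef_unitmx //; apply: (le_trans IHr).
apply: ler_peMr; first exact: ltW (sym_posdef_det_gt0 Bpd).
rewrite lerDl.
have [-> |v0] := eqVneq (v i) 0; first by rewrite /qform mulmx0 mxE.
by rewrite ltW // (sym_posdef_inv Bpd).2.
Qed.

(** The ratio [\det (A + G) / \det A] does not increase when [A] becomes [A + Q]; the quotients are
    cross-multiplied. Each new vector of [G] contributes one factor [1 + v^T (...)^-1 v] per side,
    and antitonicity of the inverse compares the two. *)
Lemma det_add_sum_outer_ratio A Q (I : Type) (r : seq I) (P : pred I)
    (v : I -> 'cV[R]_n) :
  sym_posdef A -> sym_possemidef Q ->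
  let G := \sum_(i <- r | P i) v i *m (v i)^T in
  \det (A + Q + G) * \det A <= \det (A + G) * \det (A + Q).
Proof.
move=> Apd Qpsd /=; elim: r => [|i r IHr].
  by rewrite big_nil !addr0 mulrC.
rewrite big_cons; case: (P i) => //.
rewrite [v i *m _ + _]addrC !addrA.
set G := \sum_(i <- r | _) _ in IHr *.
have Gpsd : sym_possemidef G by exact: sym_possemidef_sum_outer.
have AGpd := sym_posdefD Apd Gpsd.
have AQGpd := sym_posdefD (sym_posdefD Apd Qpsd) Gpsd.
rewrite !det_add_outer ?sym_posdef_unitmx //.
rewrite mulrAC [X in _ <= X]mulrAC; apply: ler_pM => //.
- by rewrite mulr_ge0 // ltW // sym_posdef_det_gt0.
- rewrite addr_ge0 //.
  have [-> |v0] := eqVneq (v i) 0; first by rewrite /qform mulmx0 mxE.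
  by rewrite ltW // (sym_posdef_inv AQGpd).2.
- by rewrite lerD2l addrAC qform_inv_antitone.
Qed.

End PositiveSemidefinite.

(** * The greedy guarantee for monotone submodular functions *)

Section GreedyGuarantee.
Variables (R : realType) (T : finType) (f : {set T} -> R).
Implicit Types (A B S Sstar : {set T}) (s : T) (K : nat).

(** The elements of [B] join [A] one at a time, and submodularity bounds each gain by the gain over
    [A] alone. *)
Lemma submodular_union_le A B (c : R) :
  submodular_setfun f -> 0 <= c ->
  (forall s, s \notin A -> f (A :|: [set s]) - f A <= c) ->
  f (A :|: B) - f A <= #|B|%:R * c.
Proof.
move=> fsub c0 hc; move: {2}#|B| (erefl #|B|) => k.
elim: k B => [|k IHk] B cB.
  by move/eqP: cB; rewrite cards_eq0 => /eqP->; rewrite finset.setU0 subrr cards0 mul0r.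
have /card_gt0P[s sB] : (0 < #|B|)%N by rewrite cB.
have cBs : #|B :\ s| = k by move: cB; rewrite (cardsD1 s) sB => -[].
have := IHk _ cBs; rewrite cBs cB -natr1 mulrDl mul1r => le_k.
have -> : A :|: B = A :|: (B :\ s) :|: [set s].
  by rewrite -finset.setUA [_ :|: [set s]]finset.setUC finset.setD1K.
(* An element already in [A] gains nothing, which [0 <= c] covers. *)
have [sA|sNA] := boolP (s \in A).
  have -> : A :|: (B :\ s) :|: [set s] = A :|: (B :\ s).
    by apply/finset.setUidPl; rewrite finset.sub1set inE sA.
  by rewrite (le_trans le_k) // lerDl.
have sNU : s \notin A :|: (B :\ s) by rewrite !inE (negPf sNA) eqxx.
have := fsub A (A :|: (B :\ s)) s (finset.subsetUl _ _) sNU.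
by have := hc s sNA; lra.
Qed.

(** The step count [K'] is kept apart from [K] so that the contraction rate stays fixed during the
    induction on the run. *)
Lemma greedy_gap K K' S Sstar :
  normalized_setfun f -> monotone_setfun f -> submodular_setfun f ->
  (0 < K)%N -> (#|Sstar| <= K)%N -> greedy f K' S ->
  f Sstar - f S <= (1 - K%:R^-1) ^+ K' * f Sstar.
Proof.
move=> f0 fmon fsub K_gt0 cS; elim=> {K' S} [|K' S s _ IH sS smax].
  by rewrite f0 subr0 expr0 mul1r.
set c := f (S :|: [set s]) - f S.
have c0 : 0 <= c by rewrite subr_ge0 fmon // finset.subsetUl.
(* Passing to [S :|: Sstar] only increases [f], and it adds at most [K] elements, none with a gain
   above the greedy gain [c]. *)
have gapc : f Sstar - f S <= K%:R * c.
  have hc t : t \notin S -> f (S :|: [set t]) - f S <= c.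
    by move=> tS; rewrite lerD2r smax.
  have := submodular_union_le Sstar fsub c0 hc.
  have : f Sstar <= f (S :|: Sstar) by rewrite fmon // finset.subsetUr.
  have : #|Sstar|%:R * c <= K%:R * c by rewrite ler_wpM2r // ler_nat.
  lra.
have KR0 : 0 < (K%:R : R) by rewrite ltr0n.
have decay : f Sstar - f (S :|: [set s]) <= (1 - K%:R^-1) * (f Sstar - f S).
  have -> : f Sstar - f (S :|: [set s]) = f Sstar - f S - c by rewrite /c; ring.
  rewrite mulrBl mul1r lerD2l lerN2 mulrC ler_pdivrMr // mulrC //.
rewrite exprS -mulrA (le_trans decay) // ler_wpM2l // subr_ge0.
by rewrite invf_le1 // ler1n.
Qed.

Lemma greedy_guarantee K S Sstar :
  normalized_setfun f -> monotone_setfun f -> submodular_setfun f ->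
  (0 < K)%N -> (#|Sstar| <= K)%N -> greedy f K S ->
  (1 - 1 / expR 1) * f Sstar <= f S.
Proof.
move=> f0 fmon fsub K_gt0 cS gS.
have gap := greedy_gap f0 fmon fsub K_gt0 cS gS.
have fS0 : 0 <= f Sstar by rewrite -f0 fmon // finset.sub0set.
have KR0 : 0 < (K%:R : R) by rewrite ltr0n.
have KV : 0 <= 1 - (K%:R : R)^-1 by rewrite subr_ge0 invf_le1 // ler1n.
(* This is [1 + x <= expR x] at [x = - K^-1], raised to the power [K]; [KV] keeps the base
   nonnegative. *)
have pw : (1 - (K%:R : R)^-1) ^+ K <= 1 / expR 1.
  rewrite div1r -expRN.
  have -> : -1 = (- K%:R^-1) * K%:R :> R by rewrite mulNr mulVf ?gt_eqF.
  rewrite expRM_natr; apply: lerXn2r; rewrite ?nnegrE ?expR_ge0 //.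
  exact: expR_ge1Dx.
have := ler_wpM2r fS0 pw; lra.
Qed.

End GreedyGuarantee.

(** * The objective as a sum of log-determinants, and its set function properties *)

Lemma ln_prod (R : realType) (I : finType) (x : I -> R) :
  (forall i, 0 < x i) -> ln (\prod_i x i) = \sum_i ln (x i).
Proof.
(* Positivity of the partial product travels along the induction, because [lnM] needs it. *)
move=> x0; pose P (p s : R) := 0 < p /\ ln p = s.
suff [] : P (\prod_i x i) (\sum_i ln (x i)) by [].
elim/big_rec2: _ => [|i s p _ [p0 <-]]; first by split; rewrite ?ln1.
by split; rewrite ?mulr_gt0 // lnM ?posrE.
Qed.

Section LogDetObjective.
Variables (R : realType) (d M N : nat) (a : 'I_N -> 'cV[R]_d).
Variables (xbar : 'I_M -> 'cV[R]_d) (Sigma : 'I_M -> 'M[R]_d).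
Variables (nu : 'I_M -> {set 'I_N}) (sigma dtil : 'I_M -> 'I_N -> R).
Hypothesis Sigma_spd : forall i, sym_posdef (Sigma i).
Implicit Types (i : 'I_M) (S U : {set beacons a}).

Local Notation g := (score a xbar sigma dtil).
Local Notation f := (fDplus a xbar Sigma nu sigma dtil).

Definition block_info i S : 'M[R]_d :=
  \sum_(j in nu i | beacon a j \in S) g i j *m (g i j)^T.

(** The diagonal block of position [i] in the posterior information [fisher_info S + prior_info]. *)
Definition block_post i S : 'M[R]_d := invmx (Sigma i) + block_info i S.

Lemma block_info_psd i S : sym_possemidef (block_info i S).
Proof. exact: sym_possemidef_sum_outer. Qed.

Lemma block_post_spd i S : sym_posdef (block_post i S).
Proof.
by apply: sym_posdefD (block_info_psd i S); exact: sym_posdef_inv.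
Qed.

Lemma block_post_det_gt0 i S : 0 < \det (block_post i S).
Proof. exact: sym_posdef_det_gt0 (block_post_spd i S). Qed.

Lemma block_infoU i S U :
  [disjoint S & U] -> block_info i (S :|: U) = block_info i S + block_info i U.
Proof.
move=> dSU; rewrite /block_info (bigID (fun j => beacon a j \in S)) /=.
congr (_ + _); apply: eq_bigl => j; rewrite !inE -!andbA; congr (_ && _).
  by rewrite andbC; case: (_ \in S).
case: (boolP (_ \in S)) => [jS|_]; last by rewrite andbT.
by rewrite (disjointFr dSU jS).
Qed.

(** The increment is again a sum of outer products: it is the added sum in the proof of monotonicity
    and the perturbation [Q] in that of submodularity. *)
Lemma block_postD i S U :
  S \subset U -> block_post i U = block_post i S + block_info i (U :\: S).
Proof.
move=> sSU; rewrite /block_post -addrA -block_infoU; last first.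
  by rewrite -finset.setI_eq0 finset.setIDA finset.setDIl finset.setDv finset.set0I.
by rewrite -[in LHS](finset.setID U S) (finset.setIidPr sSU).
Qed.

Lemma fDE S :
  fD a xbar Sigma nu sigma dtil S = \sum_i ln (\det (block_post i S)).
Proof.
rewrite /fD /fisher_info /prior_info addrC -mxdiagD det_mxdiag.
by apply: ln_prod => i; exact: block_post_det_gt0.
Qed.

Lemma fDplus_normalized : normalized_setfun f.
Proof. exact: subrr. Qed.

Lemma fDplus_monotone : monotone_setfun f.
Proof.
move=> A B sAB; rewrite lerD2r !fDE; apply: ler_sum => i _.
rewrite ler_ln ?posrE ?block_post_det_gt0 //.
rewrite (block_postD i sAB).
exact: det_le_add_sum_outer (block_post_spd i A).
Qed.

Lemma fDplus_submodular : submodular_setfun f.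
Proof.
move=> A B s sAB sB; have sA : s \notin A by apply: contra sB; exact: (fintype.subsetP sAB).
(* The shift by [fD] of the empty set cancels, and it suffices to compare the marginal gains
   position by position. *)
rewrite /fDplus !opprB !addrA !subrK !fDE -!sumrB; apply: ler_sum => i _.
have addE S : s \notin S ->
    block_post i (S :|: [set s]) = block_post i S + block_info i [set s].
  by move=> sS; rewrite /block_post block_infoU ?addrA // disjoint_sym disjoints1.
(* Moving the subtracted logarithms across turns the claim into an inequality between products of
   determinants, with [G = block_info i [set s]] and [Q = block_info i (B :\: A)]. *)
rewrite lerBlDr addrAC lerBrDr.
rewrite -!lnM ?posrE ?block_post_det_gt0 //.
rewrite ler_ln ?posrE ?mulr_gt0 ?block_post_det_gt0 // !addE // (block_postD i sAB).
exact: det_add_sum_outer_ratio (block_post_spd i A) (block_info_psd i _).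
Qed.

End LogDetObjective.

Theorem mainTheorem1 (R : realType) (d M N : nat)
    (hd : (1 <= d)%N) (hM : (1 <= M)%N) (hN : (1 <= N)%N)
    (a : 'I_N -> 'cV[R]_d) (a_inj : injective a)
    (xbar : 'I_M -> 'cV[R]_d) (Sigma : 'I_M -> 'M[R]_d)
    (nu : 'I_M -> {set 'I_N}) (sigma dtil : 'I_M -> 'I_N -> R)
    (Sigma_spd : forall i, sym_posdef (Sigma i))
    (xbar_neq : forall i j, j \in nu i -> xbar i != a j)
    (sigma_gt0 : forall i j, j \in nu i -> 0 < sigma i j ^+ 2) :
  let f := fDplus a xbar Sigma nu sigma dtil in
  [/\ normalized_setfun f, monotone_setfun f & submodular_setfun f] /\
  (forall (K : nat) (Sg Sstar : {set beacons a}),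
     (1 <= K)%N -> (K < N)%N ->
     #|Sg| = K -> greedy f K Sg ->
     budget_maximizer f K Sstar ->
     f Sg >= (1 - 1 / expR 1) * f Sstar).
Proof.
split; first by split;
  [exact: fDplus_normalized | exact: fDplus_monotone | exact: fDplus_submodular].
move=> K Sg Sstar K_gt0 _ _ gSg [cS _].
exact: (greedy_guarantee (fDplus_normalized _ _ _ _ _ _)
  (fDplus_monotone _ _ _ _ Sigma_spd) (fDplus_submodular _ _ _ _ Sigma_spd)
  K_gt0 cS gSg).
Qed.
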